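(* Let $\rho>0$, $\gamma>0$ and symmetric positive semi-definite matrices $P_i\in\mathbb{R}^{n_i\times n_i}$ ($i=1,\dots,N$) satisfy, for some $\epsilon_i>0$, $i=1,\dots,N$, $$P_i\succ \rho\Big(\frac{1}{\epsilon_i}-1\Big)A_i^\top A_i,\quad i=1,2,\ldots,N,\qquad\text{and}\qquad \sum_{i=1}^N \epsilon_i<2-\gamma .$$ Then the sequence $\{\mathbf{u}^k\}$, $\mathbf{u}^k=(\mathbf{x}_1^k,\dots,\mathbf{x}_N^k,\lambda^k)$, generated by Proximal Jacobian ADMM (from any initial point $\mathbf{u}^0$) converges to a solution $\mathbf{u}^*$ of the problem $$\min_{\mathbf{x}_1,\ldots,\mathbf{x}_N}\ \sum_{i=1}^N f_i(\mathbf{x}_i)\quad\text{s.t.}\quad \sum_{i=1}^N A_i\mathbf{x}_i=c .$$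
   Context: Setting: $N\ge 2$, $\mathbf{x}_i\in\mathbb{R}^{n_i}$, $A_i\in\mathbb{R}^{m\times n_i}$, $c\in\mathbb{R}^m$, and $f_i:\mathbb{R}^{n_i}\to(-\infty,+\infty]$ are closed proper convex functions. It is assumed that a saddle point (KKT point) exists, i.e. some $\mathbf{u}^*=(\mathbf{x}_1^*,\dots,\mathbf{x}_N^*,\lambda^* )$ with $\lambda^*\in\mathbb{R}^m$, $A_i^\top\lambda^*\in\partial f_i(\mathbf{x}_i^* )$ for all $i$, and $\sum_{i=1}^N A_i\mathbf{x}_i^*=c$. A ''solution $\mathbf{u}^*$'' means such a point. $\|\cdot\|$ is the Euclidean norm, $\|\mathbf{z}\|_M^2:=\mathbf{z}^\top M\mathbf{z}$ for symmetric positive semi-definite $M$; $M\succ M'$ (resp. $M\succeq M'$) means $M-M'$ is positive definite (resp. semi-definite). Proximal Jacobian ADMM with parameters $\rho>0$, $\gamma>0$, $P_i\succeq 0$: start from arbitrary $\mathbf{x}_i^0\in\mathbb{R}^{n_i}$, $\lambda^0\in\mathbb{R}^m$; for $k=0,1,\dots$, for all $i=1,\dots,N$ (in parallel) $$\mathbf{x}_i^{k+1}=\operatorname*{arg\,min}_{\mathbf{x}_i}\ f_i(\mathbf{x}_i)+\frac{\rho}{2}\Big\|A_i\mathbf{x}_i+\sum_{j\ne i}A_j\mathbf{x}_j^k-c-\frac{\lambda^k}{\rho}\Big\|^2+\frac12\|\mathbf{x}_i-\mathbf{x}_i^k\|_{P_i}^2,$$ then $\lambda^{k+1}=\lambda^k-\gamma\rho\big(\sum_{i=1}^N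 A_i\mathbf{x}_i^{k+1}-c\big)$. *)

(* Defs.v *)
From HB Require Import structures.
From mathcomp Require Import all_boot all_order all_algebra.
From mathcomp Require Import all_classical all_reals all_analysis.

Set Implicit Arguments.
Unset Strict Implicit.
Unset Printing Implicit Defensive.
Import Order.TTheory GRing.Theory Num.Theory.
Import numFieldNormedType.Exports.
Local Open Scope classical_set_scope.
Local Open Scope ring_scope.

Definition dotv (R : realType) (n : nat) (u v : 'cV[R]_n) : R :=
  (u^T *m v) 0 0.

(* The square of the Euclidean norm; the library norm `|v| on column vectors
   is the sup norm, which induces the same topology. *)
Definition sqnorm (R : realType) (n : nat) (v : 'cV[R]_n) : R :=
  \sum_(j < n) v j 0 ^+ 2.

Definition sqnorm_mx (R : realType) (n : nat) (M : 'M[R]_n) (v : 'cV[R]_n) : R :=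
  (v^T *m M *m v) 0 0.

Definition possemidefmx (R : realType) (n : nat) (M : 'M[R]_n) : Prop :=
  M^T = M /\ forall v : 'cV[R]_n, 0 <= sqnorm_mx M v.

Definition posdefmx (R : realType) (n : nat) (M : 'M[R]_n) : Prop :=
  M^T = M /\ forall v : 'cV[R]_n, v != 0 -> 0 < sqnorm_mx M v.

Definition proper_fun (R : realType) (n : nat) (f : 'cV[R]_n -> \bar R) : Prop :=
  (forall x, f x != -oo%E) /\ (exists x, f x != +oo%E).

(* Only meant for f that do not take the value -oo, so that no (+oo) + (-oo)
   occurs on the right-hand side. *)
Definition econvex_fun (R : realType) (n : nat) (f : 'cV[R]_n -> \bar R) : Prop :=
  forall (x y : 'cV[R]_n) (t : R), 0 < t < 1 ->
    (f (t *: x + (1 - t) *: y)%R <= t%:E * f x + (1 - t)%:E * f y)%E.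

Definition closed_proper_convex (R : realType) (n : nat)
    (f : 'cV[R]_n -> \bar R) : Prop :=
  [/\ lower_semicontinuous f, proper_fun f & econvex_fun f].

(* For proper f this is empty wherever f is +oo, as it should be. *)
Definition subdifferential (R : realType) (n : nat) (f : 'cV[R]_n -> \bar R)
    (x : 'cV[R]_n) : set 'cV[R]_n :=
  [set g | forall y, (f x + (dotv g (y - x)%R)%:E <= f y)%E].

Definition is_argmin (R : realType) (n : nat) (g : 'cV[R]_n -> \bar R)
    (x : 'cV[R]_n) : Prop :=
  forall y, (g x <= g y)%E.

Definition saddle_point (R : realType) (N m : nat) (n : 'I_N -> nat)
    (A : forall i, 'M[R]_(m, n i)) (c : 'cV[R]_m)
    (f : forall i, 'cV[R]_(n i) -> \bar R)
    (x : forall i, 'cV[R]_(n i)) (lam : 'cV[R]_m) : Prop :=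
  (forall i, subdifferential (f i) (x i) ((A i)^T *m lam)) /\
  \sum_(i < N) A i *m x i = c.

Definition prox_jadmm_objective (R : realType) (N m : nat) (n : 'I_N -> nat)
    (A : forall i, 'M[R]_(m, n i)) (c : 'cV[R]_m)
    (f : forall i, 'cV[R]_(n i) -> \bar R)
    (rho : R) (P : forall i, 'M[R]_(n i))
    (x : forall i, 'cV[R]_(n i)) (lam : 'cV[R]_m)
    (i : 'I_N) (z : 'cV[R]_(n i)) : \bar R :=
  (f i z +
   (rho / 2 * sqnorm (A i *m z + \sum_(j < N | j != i) A j *m x j
                        - c - rho^-1 *: lam)
    + 2^-1 * sqnorm_mx (P i) (z - x i))%:E)%E.

(* x k i and lam k are the k-th iterates; x 0 and lam 0 are arbitrary. *)
Definition prox_jadmm_sequence (R : realType) (N m : nat) (n : 'I_N -> nat)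
    (A : forall i, 'M[R]_(m, n i)) (c : 'cV[R]_m)
    (f : forall i, 'cV[R]_(n i) -> \bar R)
    (rho gamma : R) (P : forall i, 'M[R]_(n i))
    (x : nat -> forall i, 'cV[R]_(n i)) (lam : nat -> 'cV[R]_m) : Prop :=
  forall k : nat,
    (forall i, is_argmin (@prox_jadmm_objective R N m n A c f rho P
                            (x k) (lam k) i) (x k.+1 i)) /\
    lam k.+1 = lam k - (gamma * rho) *: (\sum_(i < N) A i *m x k.+1 i - c).

(* Main.v *)
(* With G_i = P_i + rho A_i^T A_i, optimality of the proximal step says that
   A_i^T (lam^k - rho (sum_j A_j x_j^k - c)) - G_i (x_i^{k+1} - x_i^k) is a
   subgradient of f_i at x_i^{k+1}. Pairing it with the saddle point condition
   by monotonicity and bounding the cross terms by Young's inequality with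
   weights eps_i, the energy
     V_k = |lam^k - ls|^2 / (gamma rho) + sum_i |x_i^k - xs_i|_{G_i}^2
   decreases by at least
     sum_i |x_i^{k+1} - x_i^k|_{S_i}^2
       + (2 - gamma - sum_i eps_i) rho |sum_i A_i x_i^{k+1} - c|^2
   with S_i = P_i - rho (1 / eps_i - 1) A_i^T A_i positive definite. So the
   iterates are bounded and their increments and residuals vanish. A limit along
   an ultrafilter finer than \oo, which replaces a convergent subsequence, is
   again a saddle point; the energy relative to it is nonincreasing and tends to
   0 along the ultrafilter, hence tends to 0. *)

Require Import Defs.
From HB Require Import structures.
From mathcomp Require Import all_boot all_order all_algebra.
From mathcomp Require Import all_classical all_reals all_analysis.
From mathcomp Require Import ring lra.

Set Implicit Arguments.
Unset Strict Implicit.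
Unset Printing Implicit Defensive.
Import Order.TTheory GRing.Theory Num.Theory.
Import numFieldNormedType.Exports.
Local Open Scope classical_set_scope.
Local Open Scope ring_scope.

(** * Algebra of the Euclidean inner product and of quadratic forms *)

Section inner_product.
Context {R : realType}.

Lemma dotvE n (u v : 'cV[R]_n) : dotv u v = \sum_j u j 0 * v j 0.
Proof. by rewrite /dotv mxE; apply: eq_bigr => j _; rewrite mxE. Qed.

Lemma dotvC n (u v : 'cV[R]_n) : dotv u v = dotv v u.
Proof. by rewrite !dotvE; apply: eq_bigr => j _; rewrite mulrC. Qed.

Lemma dotvDl n (u v w : 'cV[R]_n) : dotv (u + v) w = dotv u w + dotv v w.
Proof. by rewrite /dotv linearD mulmxDl mxE. Qed.

Lemma dotvZl n a (u v : 'cV[R]_n) : dotv (a *: u) v = a * dotv u v.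
Proof. by rewrite /dotv linearZ -scalemxAl mxE. Qed.

Lemma dotvNl n (u v : 'cV[R]_n) : dotv (- u) v = - dotv u v.
Proof. by rewrite -scaleN1r dotvZl mulN1r. Qed.

Lemma dotvDr n (w u v : 'cV[R]_n) : dotv w (u + v) = dotv w u + dotv w v.
Proof. by rewrite dotvC dotvDl !(dotvC w). Qed.

Lemma dotvZr n a (u v : 'cV[R]_n) : dotv u (a *: v) = a * dotv u v.
Proof. by rewrite dotvC dotvZl dotvC. Qed.

Lemma dotvNr n (u v : 'cV[R]_n) : dotv u (- v) = - dotv u v.
Proof. by rewrite dotvC dotvNl dotvC. Qed.

Lemma dotv0r n (u : 'cV[R]_n) : dotv u 0 = 0.
Proof. by rewrite -(scale0r 0) dotvZr mul0r. Qed.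

Lemma dotv_sumr n I (r : seq I) (F : I -> 'cV[R]_n) (u : 'cV[R]_n) :
  dotv u (\sum_(i <- r) F i) = \sum_(i <- r) dotv u (F i).
Proof. by apply: (big_morph (dotv u) (dotvDr u)); rewrite dotv0r. Qed.

Lemma dotv_trmx m n (M : 'M[R]_(m, n)) u v :
  dotv (M^T *m u) v = dotv u (M *m v).
Proof. by rewrite /dotv trmx_mul trmxK mulmxA. Qed.

Lemma sqnormE n (v : 'cV[R]_n) : sqnorm v = dotv v v.
Proof. by rewrite dotvE; apply: eq_bigr => j _; rewrite expr2. Qed.

Lemma sqnorm_mxE n (M : 'M[R]_n) (v : 'cV[R]_n) :
  sqnorm_mx M v = dotv v (M *m v).
Proof. by rewrite /sqnorm_mx /dotv mulmxA. Qed.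

Lemma sqnorm_mx1 n (v : 'cV[R]_n) : sqnorm_mx 1%:M v = sqnorm v.
Proof. by rewrite sqnorm_mxE mul1mx sqnormE. Qed.

Lemma sqnorm_ge0 n (v : 'cV[R]_n) : 0 <= sqnorm v.
Proof. by apply: sumr_ge0 => j _; rewrite sqr_ge0. Qed.

Lemma sqr_coord_le_sqnorm n (v : 'cV[R]_n) j : v j 0 ^+ 2 <= sqnorm v.
Proof.
rewrite /sqnorm (bigD1 j) //= lerDl; apply: sumr_ge0 => i _; exact: sqr_ge0.
Qed.

Lemma sqnorm_eq0 n (v : 'cV[R]_n) : (sqnorm v == 0) = (v == 0).
Proof.
apply/eqP/eqP => [v0|->]; last first.
  by rewrite /sqnorm big1 // => j _; rewrite mxE expr0n.
apply/colP => j; rewrite mxE; apply/eqP.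
by rewrite -sqrf_eq0 eq_le sqr_ge0 -v0 sqr_coord_le_sqnorm.
Qed.

Lemma sqnormZ n a (v : 'cV[R]_n) : sqnorm (a *: v) = a ^+ 2 * sqnorm v.
Proof. by rewrite !sqnormE dotvZl dotvZr mulrA expr2. Qed.

Lemma sqnorm_mxZ n (M : 'M[R]_n) a (v : 'cV[R]_n) :
  sqnorm_mx M (a *: v) = a ^+ 2 * sqnorm_mx M v.
Proof. by rewrite !sqnorm_mxE -scalemxAr dotvZl dotvZr mulrA expr2. Qed.

Lemma posdefmx1 n : posdefmx (1%:M : 'M[R]_n).
Proof.
split=> [|v v0]; first exact: trmx1.
by rewrite sqnorm_mx1 lt0r sqnorm_eq0 v0 sqnorm_ge0.
Qed.

Lemma posdefmx_ge0 n (M : 'M[R]_n) (v : 'cV[R]_n) :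
  posdefmx M -> 0 <= sqnorm_mx M v.
Proof.
move=> [_ Mp]; have [->|/Mp/ltW//] := eqVneq v 0.
by rewrite sqnorm_mxE mulmx0 dotv0r.
Qed.

End inner_product.

(** * Limits of vectors, compactness along ultrafilters, and closedness of subdifferentials *)

Section convergence.
Context {R : realType}.

Lemma cvg_sumr T (F : set_system T) {FF : Filter F} (V : normedModType R)
    (I : Type) (r : seq I) (u : I -> T -> V) (p : I -> V) :
  (forall i, u i @ F --> p i) ->
  (fun t => \sum_(i <- r) u i t) @ F --> \sum_(i <- r) p i.
Proof.
move=> up; apply: cvg_big => // -[a b]; exact: add_continuous.
Qed.

Lemma cvg_mx_coord T (F : set_system T) {FF : Filter F} m n
    (u : T -> 'M[R]_(m, n)) (p : 'M[R]_(m, n)) :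
  (forall i j, (fun t => u t i j) @ F --> p i j) -> u @ F --> p.
Proof.
move=> uij; apply/cvgrPdist_lt => e e0.
have : \forall t \near F, forall i j, ball (p i j) e (u t i j).
  apply: filter_forall => i; apply: filter_forall => j.
  by apply: (uij i j); exact: nbhsx_ballx.
apply: filterS => t ut.
have : ball p e (u t) by split.
by rewrite -ball_normE.
Qed.

Lemma cvg_dotv T (F : set_system T) {FF : Filter F} n
    (u v : T -> 'cV[R]_n) (p q : 'cV[R]_n) :
  u @ F --> p -> v @ F --> q -> (fun t => dotv (u t) (v t)) @ F --> dotv p q.
Proof.
move=> up vq; rewrite dotvE; under eq_fun do rewrite dotvE.
apply: cvg_sumr => j; apply: cvgM.
- exact: (cvg_comp _ _ up (@coord_continuous _ _ _ j 0 p)).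
- exact: (cvg_comp _ _ vq (@coord_continuous _ _ _ j 0 q)).
Qed.

Lemma cvg_mulmx T (F : set_system T) {FF : Filter F} m n
    (M : 'M[R]_(m, n)) (u : T -> 'cV[R]_n) (p : 'cV[R]_n) :
  u @ F --> p -> (fun t => M *m u t) @ F --> M *m p.
Proof.
move=> up; apply: cvg_mx_coord => i j; rewrite mxE.
under eq_fun do rewrite mxE.
apply: cvg_sumr => k; apply: cvgM; first exact: cvg_cst.
exact: (cvg_comp _ _ up (@coord_continuous _ _ _ k j p)).
Qed.

Lemma cvg_sqnorm_mx T (F : set_system T) {FF : Filter F} n
    (M : 'M[R]_n) (u : T -> 'cV[R]_n) (p : 'cV[R]_n) :
  u @ F --> p -> (fun t => sqnorm_mx M (u t)) @ F --> sqnorm_mx M p.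
Proof.
move=> up; rewrite sqnorm_mxE; under eq_fun do rewrite sqnorm_mxE.
by apply: cvg_dotv => //; exact: cvg_mulmx.
Qed.

(** Compactness of [[-B, B]] gives the image filter a cluster point. An ultrafilter contains each
    set or its complement, so it converges to any of its cluster points. *)
Lemma ultra_cvg_bounded T (U : set_system T) (UU : UltraFilter U)
    (u : T -> R) (B : R) :
  (forall t, `|u t| <= B) -> exists p : R, u @ U --> p.
Proof.
move=> uB.
have uU : (u @ U) [set` `[- B, B]].
  by apply: (@filterE _ U) => t; rewrite /= in_itv /= -ler_norml; exact: uB.
have [p [_ clp]] := @segment_compact R (- B) B (u @ U) _ uU.
exists p => A Ap.
have [//|UA] := in_ultra_setVsetC (u @^-1` A) UU.
by have [y []] := clp (~` A) A UA Ap.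
Qed.

Lemma ultra_cvg_bounded_cV T (U : set_system T) (UU : UltraFilter U) n
    (u : T -> 'cV[R]_n) (B : R) :
  (forall t, sqnorm (u t) <= B) -> exists p : 'cV[R]_n, u @ U --> p.
Proof.
move=> uB.
have /choice[p pP] (j : 'I_n) : exists p : R, (fun t => u t j 0) @ U --> p.
  (* The bound [B + 1] avoids a square root: a real [s] with [s ^+ 2 <= B] satisfies
     [|s| <= s ^+ 2 + 1 <= B + 1]. *)
  apply: (@ultra_cvg_bounded _ _ UU _ (B + 1)) => t.
  have := le_trans (sqr_coord_le_sqnorm (u t) j) (uB t).
  by rewrite ler_norml => h; apply/andP; split; nra.
exists (\col_j p j); apply: cvg_mx_coord => j k.
by rewrite mxE (ord1 k); exact: pP.
Qed.

(** Otherwise there are unit vectors on which the form is at most [1 / (k + 1)]. Their limit along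
    an ultrafilter is nonzero and the form is nonpositive there, against definiteness. *)
Lemma posdefmx_coercive n (M : 'M[R]_n) : posdefmx M ->
  exists2 k : R, 0 < k & forall v : 'cV[R]_n, k * sqnorm v <= sqnorm_mx M v.
Proof.
move=> MP; apply: contrapT => noK.
have /choice[v vP] (k : nat) : exists v : 'cV[R]_n,
    sqnorm v = 1 /\ sqnorm_mx M v <= k.+1%:R^-1.
  apply: contrapT => nov; apply: noK; exists k.+1%:R^-1 => // w.
  have [->|w0] := eqVneq w 0.
    by rewrite -(scale0r 0) sqnormZ sqnorm_mxZ expr0n !mul0r mulr0.
  have sw : 0 < sqnorm w by rewrite lt0r sqnorm_eq0 w0 sqnorm_ge0.
  rewrite leNgt; apply/negP => lt_w; apply: nov.
  (* A vector [w] violating coercivity with constant [1 / (k + 1)] is normalised to length 1. *)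
  exists ((Num.sqrt (sqnorm w))^-1 *: w).
  rewrite sqnormZ sqnorm_mxZ exprVn sqr_sqrtr ?sqnorm_ge0//.
  by rewrite mulVf ?gt_eqF// mulrC ler_pdivrMr // ltW.
have [U [UU ooU]] := ultraFilterLemma (@eventually_filter).
have v1 k : sqnorm (v k) <= 1 by rewrite (vP k).1.
have [p vp] := ultra_cvg_bounded_cV UU v1.
have sp : 1 <= sqnorm p.
  rewrite -sqnorm_mx1; apply: (cvgr_to_ge (cvg_sqnorm_mx (M := 1%:M) vp)).
  by apply: filterE => k /=; rewrite sqnorm_mx1 (vP k).1.
have hU : (fun k => k.+1%:R^-1 : R) @ U --> (0 : R).
  exact: cvg_trans (cvg_app _ ooU) (@cvg_harmonic R).
have : sqnorm_mx M p <= 0.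
  apply: (ler_cvg_to (cvg_sqnorm_mx (M := M) vp) hU).
  by apply: filterE => k; exact: (vP k).2.
apply/negP; rewrite -ltNge; apply: MP.2.
by rewrite -sqnorm_eq0 gt_eqF// (lt_le_trans _ sp).
Qed.

Lemma cvg0_sqnorm_mx T (F : set_system T) {FF : Filter F} n
    (M : 'M[R]_n) (u : T -> 'cV[R]_n) : posdefmx M ->
  (fun t => sqnorm_mx M (u t)) @ F --> (0 : R) -> u @ F --> (0 : 'cV[R]_n).
Proof.
move=> /posdefmx_coercive[k k0 kM] /cvgr0Pnorm_lt uM.
apply: cvg_mx_coord => i j; rewrite mxE (ord1 j).
apply/cvgr0Pnorm_lt => e e0.
(* By coercivity, a form below [k * e ^+ 2] forces every squared coordinate below [e ^+ 2]. *)
have := uM (k * e ^+ 2) (mulr_gt0 k0 (exprn_gt0 2 e0)).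
apply: filterS => t /(le_lt_trans (ler_norm _)) ut.
have := le_lt_trans (kM (u t)) ut; rewrite ltr_pM2l //.
move=> /(le_lt_trans (sqr_coord_le_sqnorm _ i)).
by rewrite -real_normK ?num_real// ltr_pXn2r ?nnegrE// ltW.
Qed.

(** [V] is nonincreasing and bounded below, hence convergent; its successive differences tend to 0
    and dominate [a]. *)
Lemma cvg0_descent (V a : nat -> R) :
  (forall k, 0 <= V k) -> (forall k, 0 <= a k) ->
  (forall k, a k <= V k - V k.+1) -> a @ \oo --> (0 : R).
Proof.
move=> V0 a0 aV.
have /cvg_ex[l Vl] : cvgn V.
  apply: nonincreasing_is_cvgn.
    by apply/nonincreasing_seqP => k; have := a0 k; have := aV k; lra.
  by exists 0 => _ [k _ <-].
have VV : (fun k => V k - V k.+1) @ \oo --> (0 : R).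
  rewrite -(subrr l); apply: cvgB => //.
  by rewrite (@cvg_shiftS _ V).
apply: (@squeeze_cvgr _ _ _ _ (fun=> 0) _ a _ 0 (cvg_cst 0) VV).
by apply: filterE => k; rewrite a0 aV.
Qed.

(** Convergence along [U] yields one index where [V] is below [e], and monotonicity keeps it there.
    This passes from the ultrafilter limit to the limit of the whole sequence. *)
Lemma cvg0_nonincreasing (U : set_system nat) {UU : ProperFilter U}
    (V : nat -> R) : nonincreasing_seq V -> (forall k, 0 <= V k) ->
  V @ U --> (0 : R) -> V @ \oo --> (0 : R).
Proof.
move=> Vdecr V0 /cvgr0Pnorm_lt VU; apply/cvgr0Pnorm_lt => e /VU/filter_ex[k Vk].
exists k => // j /= kj; apply: le_lt_trans Vk.
by rewrite !ger0_norm// Vdecr.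
Qed.

(** At a [y] with [f y] finite, the subgradient inequality bounds [f (x t)] above by a convergent
    real quantity, and lower semicontinuity carries this bound to [p]. *)
Lemma subdifferential_closed T (F : set_system T) {FF : ProperFilter F} n
    (f : 'cV[R]_n -> \bar R) (x g : T -> 'cV[R]_n) (p q : 'cV[R]_n) :
  lower_semicontinuous f -> proper_fun f ->
  x @ F --> p -> g @ F --> q ->
  (forall t, subdifferential f (x t) (g t)) -> subdifferential f p q.
Proof.
move=> flsc [fNoo _] xp gq xg y /=.
case fy : (f y) => [r| |]; [|by rewrite leey|by have := fNoo y; rewrite fy].
have bq : (fun t => r - dotv (g t) (y - x t)) @ F --> r - dotv q (y - p).
  apply: cvgB; first exact: cvg_cst.
  by apply: cvg_dotv => //; apply: cvgB => //; exact: cvg_cst.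
rewrite -leeBrDr// -EFinB leNgt; apply/negP => lt_f.
(* A real level strictly between the limit bound and [f p]: the midpoint if [f p] is finite, the
   bound plus 1 if it is [+oo]. *)
have [a ba af] : exists2 a : R, r - dotv q (y - p) < a & (a%:E < f p)%E.
  case fp : (f p) lt_f => [s| |] //.
    rewrite lte_fin => /midf_lt[l1 l2].
    by exists ((r - dotv q (y - p) + s) / 2); rewrite ?lte_fin.
  by move=> _; exists (r - dotv q (y - p) + 1); rewrite ?ltry ?ltrDl.
have [W Wp aW] := flsc _ _ af.
have [t [/aW aft bt]] := filter_ex
  (filterI (xp _ Wp : F (x @^-1` W)) (cvgr_lt _ bq _ ba)).
have := xg t y; rewrite fy -leeBrDr// -EFinB => ft.
have := lt_le_trans aft ft; rewrite lte_fin => /lt_trans/(_ bt).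
by rewrite ltxx.
Qed.

End convergence.

(** * Subgradients of proper convex functions: monotonicity and first-order optimality *)

Section convexity.
Context {R : realType} {n : nat}.
Implicit Types (f : 'cV[R]_n -> \bar R) (x y g h : 'cV[R]_n).

Lemma subdifferential_fin_num f x g :
  proper_fun f -> subdifferential f x g -> f x \is a fin_num.
Proof.
move=> [fNoo [z fz]] /(_ z) /= fxz; rewrite fin_numE fNoo /=.
apply: contraNneq fz => fx; move: fxz.
by rewrite fx addye // leye_eq.
Qed.

(** The two subgradient inequalities, each tested at the other point, are added; the values of [f]
    are finite and cancel. *)
Lemma subdifferential_monotone f x y g h : proper_fun f ->
  subdifferential f x g -> subdifferential f y h -> 0 <= dotv (g - h) (x - y).
Proof.
move=> fP fx fy; have := fx y; have := fy x => /=.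
rewrite -(fineK (subdifferential_fin_num fP fx)).
rewrite -(fineK (subdifferential_fin_num fP fy)) -!EFinD !lee_fin.
rewrite !(dotvDl, dotvNl, dotvDr, dotvNr); lra.
Qed.

(** Fermat's rule for [f + q]. The smooth term [q] enters only through an exact quadratic expansion
    along lines through [x], which makes [g] its gradient there. Minimality is tested at
    [x + t (y - x)], convexity bounds [f] there, and [t] is taken small after division by [t]. *)
Lemma argmin_subdifferential f (q : 'cV[R]_n -> R) x g : proper_fun f ->
  econvex_fun f -> is_argmin (fun z => (f z + (q z)%:E)%E) x ->
  (forall d, exists C, forall t,
     q (x + t *: d) = q x + t * dotv g d + t ^+ 2 * C) ->
  subdifferential f x (- g).
Proof.
move=> [fNoo [z fz]] fconv xmin qE y /=.
have fx : f x \is a fin_num.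
  rewrite fin_numE fNoo /=; apply: contraNneq fz => fxoo.
  have := xmin z; rewrite fxoo addye // leye_eq.
  by case: (f z).
case fy : (f y) => [r| |]; [|by rewrite leey|by have := fNoo y; rewrite fy].
rewrite -(fineK fx) -EFinD lee_fin dotvNl.
have [C qC] := qE (y - x); set s := dotv g (y - x).
have key t : 0 < t < 1 -> fine (f x) <= r + s + t * C.
  move=> t01; have [t0 t1] := andP t01.
  have := le_trans (xmin (t *: y + (1 - t) *: x))
    (leeD2r _ (fconv y x t t01)).
  have -> : t *: y + (1 - t) *: x = x + t *: (y - x).
    by rewrite scalerBl scale1r scalerBr addrCA addrA.
  rewrite qC fy -(fineK fx) -!EFinM -!EFinD lee_fin -/s => h.
  rewrite -(ler_pM2l t0); nra.
rewrite leNgt; apply/negP => lt_r.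
(* If the inequality failed by [e > 0], [key] would give [e <= t * C] for all [t] in [(0, 1)]. The
   choice [t = e / (2 (e + |C|))] makes [t * C < e / 2], a contradiction. *)
set e := fine (f x) - s - r; have e0 : 0 < e by rewrite /e; lra.
have C0 : 0 < 2 * (e + `|C|) by rewrite mulr_gt0// ltr_wpDr.
have t01 : 0 < e / (2 * (e + `|C|)) < 1.
  by rewrite divr_gt0//= ltr_pdivrMr// mul1r; have := normr_ge0 C; lra.
have /andP[t0 _] := t01.
have tC : e / (2 * (e + `|C|)) * (e + `|C|) = e / 2.
  by field; rewrite gt_eqF// ltr_wpDr.
have := key _ t01; have := ler_wpM2l (ltW t0) (ler_norm C).
have := mulr_gt0 t0 e0; move: tC; rewrite mulrDr /e; lra.
Qed.

End convexity.

(** * Optimality conditions and energy descent for one step of the algorithm *)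

Lemma sqnorm_mx_add_gram {R : realType} (m n : nat) (M : 'M[R]_n) a
    (B : 'M[R]_(m, n)) v :
  sqnorm_mx (M + a *: (B^T *m B)) v = sqnorm_mx M v + a * sqnorm (B *m v).
Proof.
rewrite !sqnorm_mxE mulmxDl dotvDr -scalemxAl dotvZr -mulmxA sqnormE.
by rewrite (dotvC v (B^T *m _)) dotv_trmx.
Qed.

(** Expansion of [|u - e v|^2 >= 0], divided by [e]. *)
Lemma dotv_young {R : realType} n e (u v : 'cV[R]_n) : 0 < e ->
  2 * dotv u v <= e^-1 * sqnorm u + e * sqnorm v.
Proof.
move=> e0; have := sqnorm_ge0 (u - e *: v).
rewrite !sqnormE !(dotvDl, dotvNl, dotvDr, dotvNr, dotvZl, dotvZr) (dotvC v u).
by move=> h; rewrite -(ler_pM2l e0) mulrDr mulVKf ?gt_eqF//; lra.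
Qed.

Section step.
Context {R : realType} {N m : nat} {n : 'I_N -> nat}.
Variables (A : forall i, 'M[R]_(m, n i)) (c : 'cV[R]_m).
Variables (f : forall i, 'cV[R]_(n i) -> \bar R) (rho gamma : R).
Arguments f : clear implicits.
Variable P : forall i, 'M[R]_(n i).
Hypothesis hf : forall i, closed_proper_convex (f i).
Hypotheses (hrho : 0 < rho) (hgamma : 0 < gamma).
Hypothesis hP : forall i, possemidefmx (P i).

Definition residual (x : forall i, 'cV[R]_(n i)) : 'cV[R]_m :=
  \sum_(i < N) A i *m x i - c.

(** The Hessian of the quadratic part of the i-th subproblem. *)
Definition prox_metric i : 'M[R]_(n i) := P i + rho *: ((A i)^T *m A i).

Lemma trmx_prox_metric i : (prox_metric i)^T = prox_metric i.
Proof. by rewrite linearD linearZ /= trmx_mul trmxK (hP i).1. Qed.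

Lemma subdifferential_prox_step x lam i z :
  is_argmin (prox_jadmm_objective A c f rho P x lam (i := i)) z ->
  subdifferential (f i) z
    ((A i)^T *m (lam - rho *: residual x) - prox_metric i *m (z - x i)).
Proof.
move=> zmin; have [_ fP fC] := hf i.
set b := \sum_(j < N | j != i) A j *m x j - c - rho^-1 *: lam.
pose g := rho *: ((A i)^T *m (A i *m z + b)) + P i *m (z - x i).
(* [g] is the gradient at [z] of the quadratic part. Since [A i *m z + b] equals [A i *m (z - x i) +
   residual x - rho^-1 *: lam], its negative is the claimed subgradient. *)
rewrite (_ : _ - _ = - g); last first.
  rewrite /g /b /residual (bigD1 i) //= /prox_metric.
  set B := \sum_(_ < _ | _) _.
  rewrite !mulmxDl -!scalemxAl -!mulmxA.
  rewrite !(mulmxDr, mulmxN, opprD, scalerDr, scalerN, opprK, =^~ scalemxAr).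
  rewrite scalerA mulfV ?gt_eqF// scale1r.
  move: (A i *m x i) (A i *m z) => u v.
  move: (_ *m lam) (_ *m u) (_ *m v) (_ *m B) (_ *m c) (_ *m z) (P i *m x i).
  by move=> *; apply/colP => j; rewrite !mxE; ring.
apply: (argmin_subdifferential (q := fun z => rho / 2 * sqnorm (A i *m z + b)
  + 2^-1 * sqnorm_mx (P i) (z - x i))) => // [y|d].
  by have := zmin y; rewrite /prox_jadmm_objective /b !addrA.
(* The second-order coefficient is the quadratic part evaluated on the direction [d]. *)
exists (rho / 2 * sqnorm (A i *m d) + 2^-1 * sqnorm_mx (P i) d) => t.
rewrite (addrAC z) mulmxDr -scalemxAr (addrAC (A i *m z)).
rewrite /g dotvDl dotvZl dotv_trmx.
move: (A i *m z + b) (z - x i) => u w.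
have Pw : dotv (P i *m w) d = dotv w (P i *m d).
  by rewrite -{1}(hP i).1 dotv_trmx.
rewrite !sqnormE !sqnorm_mxE Pw mulmxDr -scalemxAr.
rewrite !(dotvDl, dotvDr, dotvZl, dotvZr) (dotvC _ u) (dotvC d) Pw.
by field.
Qed.

(** The law of cosines for the form [M]; it turns the proximal cross term into a difference of
    energies plus the squared step. *)
Lemma sqnorm_mx_three_point k (M : 'M[R]_k) (a b d : 'cV[R]_k) : M^T = M ->
  2 * dotv (M *m (a - b)) (a - d) =
  sqnorm_mx M (a - d) - sqnorm_mx M (b - d) + sqnorm_mx M (a - b).
Proof.
move=> MT; rewrite !sqnorm_mxE.
have -> : b - d = (a - d) - (a - b).
  by rewrite opprB addrCA addrAC subrr add0r addrC.
move: (a - d) (a - b) => u v.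
rewrite -{1}MT dotv_trmx !(mulmxDr, mulmxN, dotvDl, dotvNl, dotvDr, dotvNr).
have -> : dotv v (M *m u) = dotv u (M *m v) by rewrite -dotv_trmx MT dotvC.
ring.
Qed.

Definition lyapunov (xs : forall i, 'cV[R]_(n i)) (ls : 'cV[R]_m)
    (x : forall i, 'cV[R]_(n i)) (lam : 'cV[R]_m) : R :=
  (gamma * rho)^-1 * sqnorm (lam - ls) +
  \sum_(i < N) sqnorm_mx (prox_metric i) (x i - xs i).

Variable eps : 'I_N -> R.
Hypothesis heps : forall i, 0 < eps i.

Definition slack i : 'M[R]_(n i) :=
  P i - (rho * ((eps i)^-1 - 1)) *: ((A i)^T *m A i).

(** The term split off from the metric is exactly what Young's inequality with weight [eps i]
    consumes. *)
Lemma sqnorm_prox_metric_slack i v : sqnorm_mx (prox_metric i) v =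
  sqnorm_mx (slack i) v + rho * ((eps i)^-1 * sqnorm (A i *m v)).
Proof.
by rewrite /prox_metric /slack -scaleNr !sqnorm_mx_add_gram; ring.
Qed.

Lemma lyapunov_descent xs ls x lam x' : saddle_point A c f xs ls ->
  (forall i,
    is_argmin (prox_jadmm_objective A c f rho P x lam (i := i)) (x' i)) ->
  \sum_(i < N) sqnorm_mx (slack i) (x' i - x i) +
    (2 - gamma - \sum_(i < N) eps i) * rho * sqnorm (residual x') <=
  lyapunov xs ls x lam -
    lyapunov xs ls x' (lam - (gamma * rho) *: residual x').
Proof.
move=> [xsP Axs] x'min.
set r := residual x'.
set D := \sum_(i < N) A i *m (x' i - x i).
(* The subgradients involve the old residual, while the multiplier update involves the new one; they
   differ by the total increment [D]. *)
have rE : residual x = r - D.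
  have -> : D = \sum_(i < N) A i *m x' i - \sum_(i < N) A i *m x i.
    by rewrite -sumrB; apply: eq_bigr => i _; rewrite mulmxBr.
  by rewrite /r /residual opprB [RHS]addrC addrA subrK.
(* Monotonicity of the subdifferential between [x' i] and [xs i], rewritten by the three-point
   identity. *)
have mono i : sqnorm_mx (prox_metric i) (x' i - xs i)
    - sqnorm_mx (prox_metric i) (x i - xs i)
    + sqnorm_mx (prox_metric i) (x' i - x i)
    <= 2 * dotv (lam - rho *: (r - D) - ls) (A i *m (x' i - xs i)).
  rewrite -sqnorm_mx_three_point ?trmx_prox_metric// ler_pM2l// -subr_ge0.
  have [_ fP _] := hf i.
  have := subdifferential_monotone fP
    (subdifferential_prox_step (x'min i)) (xsP i).
  by rewrite rE !(dotvDl, dotvNl, dotv_trmx); lra.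
have young i : 2 * dotv r (A i *m (x' i - x i)) <=
    (eps i)^-1 * sqnorm (A i *m (x' i - x i)) + eps i * sqnorm r.
  by rewrite dotvC; exact: dotv_young.
have monoS := @ler_sum _ _ (index_enum 'I_N) predT _ _ (fun i _ => mono i).
have youngS := @ler_sum _ _ (index_enum 'I_N) predT _ _ (fun i _ => young i).
move: monoS youngS.
rewrite !big_split /= sumrN -!mulr_sumr -!mulr_suml -!dotv_sumr.
have -> : \sum_(i < N) A i *m (x' i - xs i) = r.
  by rewrite /r /residual -Axs -sumrB; apply: eq_bigr => i _; rewrite mulmxBr.
have -> : \sum_(i < N) sqnorm_mx (prox_metric i) (x' i - x i) =
    \sum_(i < N) sqnorm_mx (slack i) (x' i - x i) +
    rho * \sum_(i < N) (eps i)^-1 * sqnorm (A i *m (x' i - x i)).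
  rewrite mulr_sumr -big_split; apply: eq_bigr => i _.
  exact: sqnorm_prox_metric_slack.
rewrite -/D /lyapunov (addrAC lam (- (rho *: _))) (addrAC lam (- (_ *: r))).
clear rE mono young; clearbody r D; move: (lam - ls) => p.
(* The sums become opaque reals, leaving a linear inequality once the summed Young bound is
   multiplied by [rho]. *)
do ![set s := \sum_(i < N) _; move: s => ?] => monoS /(ler_wpM2l (ltW hrho)).
(* The weight of the multiplier term in the energy makes its cross term [2 * dotv p r] cancel the
   one coming from monotonicity. *)
have -> : (gamma * rho)^-1 * sqnorm (p - (gamma * rho) *: r) =
    (gamma * rho)^-1 * sqnorm p - 2 * dotv p r + gamma * rho * sqnorm r.
  rewrite !sqnormE !(dotvDl, dotvNl, dotvDr, dotvNr, dotvZl, dotvZr).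
  rewrite (dotvC r p).
  by field; rewrite !gt_eqF.
move: monoS; rewrite !(dotvDl, dotvNl, dotvZl) (dotvC D r) -sqnormE; lra.
Qed.

Hypothesis hslack : forall i, posdefmx (slack i).

Lemma posdefmx_prox_metric i : posdefmx (prox_metric i).
Proof.
split=> [|v v0]; first exact: trmx_prox_metric.
rewrite sqnorm_prox_metric_slack ltr_pwDl ?(hslack i).2//.
by rewrite !mulr_ge0 ?sqnorm_ge0 ?ltW// invr_gt0.
Qed.

Lemma sqnorm_mx_le_lyapunov xs ls x lam i :
  sqnorm_mx (prox_metric i) (x i - xs i) <= lyapunov xs ls x lam.
Proof.
rewrite /lyapunov (bigD1 i) //= addrCA lerDl addr_ge0//.
  by rewrite mulr_ge0 ?sqnorm_ge0// invr_ge0 mulr_ge0 ?ltW.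
by apply: sumr_ge0 => j _; exact: posdefmx_ge0 (posdefmx_prox_metric j).
Qed.

Lemma sqnorm_le_lyapunov xs ls x lam :
  sqnorm (lam - ls) <= gamma * rho * lyapunov xs ls x lam.
Proof.
have gr0 : 0 < gamma * rho by rewrite mulr_gt0.
rewrite mulrDr mulVKf ?gt_eqF// lerDl mulr_ge0 ?(ltW gr0)// sumr_ge0// => j _.
exact: posdefmx_ge0 (posdefmx_prox_metric j).
Qed.

Lemma lyapunov_ge0 xs ls x lam : 0 <= lyapunov xs ls x lam.
Proof.
have gr0 : 0 < gamma * rho by rewrite mulr_gt0.
rewrite -(pmulr_rge0 _ gr0).
exact: le_trans (sqnorm_ge0 _) (sqnorm_le_lyapunov _ _ _ _).
Qed.

End step.

(** * Convergence of the whole sequence to a saddle point *)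

Theorem theorem2p3 (R : realType) (N : nat) (hN : (2 <= N)%N)
    (m : nat) (n : 'I_N -> nat)
    (A : forall i : 'I_N, 'M[R]_(m, n i)) (c : 'cV[R]_m)
    (f : forall i : 'I_N, 'cV[R]_(n i) -> \bar R)
    (hf : forall i : 'I_N, closed_proper_convex (f i))
    (hsaddle : exists (xs : forall i : 'I_N, 'cV[R]_(n i)) (ls : 'cV[R]_m),
        saddle_point A c f xs ls)
    (rho gamma : R) (hrho : 0 < rho) (hgamma : 0 < gamma)
    (P : forall i : 'I_N, 'M[R]_(n i))
    (hP : forall i : 'I_N, possemidefmx (P i))
    (hPeps : exists eps : 'I_N -> R,
        [/\ forall i : 'I_N, 0 < eps i,
            forall i : 'I_N,
              posdefmx (P i - (rho * ((eps i)^-1 - 1)) *: ((A i)^T *m A i)) &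
            \sum_(i < N) eps i < 2 - gamma])
    (x : nat -> forall i : 'I_N, 'cV[R]_(n i)) (lam : nat -> 'cV[R]_m)
    (hseq : prox_jadmm_sequence A c f rho gamma P x lam) :
  exists (xs : forall i : 'I_N, 'cV[R]_(n i)) (ls : 'cV[R]_m),
    [/\ saddle_point A c f xs ls,
        forall i : 'I_N, (fun k : nat => x k i) @ \oo --> xs i &
        lam @ \oo --> ls].
Proof.
have [eps [heps hslack hsum]] := hPeps.
have [xs0 [ls0 sp0]] := hsaddle.
have Gpos i : posdefmx (prox_metric A rho P i).
  exact: (posdefmx_prox_metric hrho hP heps hslack).
(* The guaranteed decrease of the energy at step [k]; it is the same for every saddle point. *)
pose a k := \sum_(i < N) sqnorm_mx (slack A rho P eps i) (x k.+1 i - x k i) +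
  (2 - gamma - \sum_(i < N) eps i) * rho * sqnorm (residual A c (x k.+1)).
pose V xs ls k := lyapunov A rho gamma P xs ls (x k) (lam k).
have Sge0 i v : 0 <= sqnorm_mx (slack A rho P eps i) v.
  exact: posdefmx_ge0 (hslack i).
have coef0 : 0 < (2 - gamma - \sum_(i < N) eps i) * rho.
  by rewrite mulr_gt0// subr_gt0.
have descent xs ls k : saddle_point A c f xs ls ->
    a k <= V xs ls k - V xs ls k.+1.
  move=> sp; have [xmin lamE] := hseq k; rewrite /V lamE.
  exact: lyapunov_descent.
have a0 k : 0 <= a k.
  by rewrite addr_ge0 ?sumr_ge0// mulr_ge0 ?sqnorm_ge0// ltW.
have V0 xs ls k : 0 <= V xs ls k.
  exact: (lyapunov_ge0 hrho hgamma hP heps hslack).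
have Vdecr xs ls : saddle_point A c f xs ls -> nonincreasing_seq (V xs ls).
  move=> sp; apply/nonincreasing_seqP => k.
  by have := descent _ _ k sp; have := a0 k; lra.
have acvg : a @ \oo --> (0 : R).
  by apply: (cvg0_descent (V0 xs0 ls0) a0) => k; exact: descent.
have dcvg i : (fun k => x k.+1 i - x k i) @ \oo --> (0 : 'cV[R]_(n i)).
  apply: (cvg0_sqnorm_mx (hslack i)).
  apply: (@squeeze_cvgr _ _ _ _ (fun=> 0) a _ _ 0 (cvg_cst 0) acvg).
  apply: filterE => k; rewrite Sge0 /a (bigD1 i) //= -addrA lerDl.
  by rewrite addr_ge0 ?sumr_ge0// mulr_ge0 ?sqnorm_ge0// ltW.
have rcvg : (fun k => residual A c (x k.+1)) @ \oo --> (0 : 'cV[R]_m).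
  apply: (cvg0_sqnorm_mx (posdefmx1 m)).
  set w := (2 - gamma - _) * rho in coef0.
  have awcvg : (fun k => w^-1 * a k) @ \oo --> (0 : R).
    by rewrite -(mulr0 w^-1); apply: cvgM => //; exact: cvg_cst.
  apply: (@squeeze_cvgr _ _ _ _ (fun=> 0) _ _ _ 0 (cvg_cst 0) awcvg).
  apply: filterE => k; rewrite sqnorm_mx1 sqnorm_ge0 /= ler_pdivlMl//.
  by rewrite lerDr sumr_ge0.
have [U [UU ooU]] := ultraFilterLemma (@eventually_filter).
have cvgU (T : topologicalType) (u : nat -> T) (l : T) :
    u @ \oo --> l -> u @ U --> l.
  exact: cvg_trans (cvg_app _ ooU).
have VleV0 k : V xs0 ls0 k <= V xs0 ls0 0%N by exact: Vdecr.
(* The initial energy bounds each block in its metric, and coercivity turns this into a Euclidean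
   bound. *)
have ex_q (i : 'I_N) : exists q : 'cV[R]_(n i), (fun k => x k i) @ U --> q.
  have [kap kap0 kapG] := posdefmx_coercive (Gpos i).
  have [k|q qP] := @ultra_cvg_bounded_cV _ _ _ UU _ (fun k => x k i - xs0 i)
    (kap^-1 * V xs0 ls0 0%N).
    rewrite ler_pdivlMl// (le_trans (kapG _))// (le_trans _ (VleV0 k))//.
    exact: (sqnorm_mx_le_lyapunov hrho hgamma hP heps hslack).
  exists (q + xs0 i); under eq_fun do rewrite -[x _ i](subrK (xs0 i)).
  by apply: cvgD => //; exact: cvg_cst.
have [ls lsP] : exists ls : 'cV[R]_m, lam @ U --> ls.
  have [k|q' qP'] := @ultra_cvg_bounded_cV _ _ _ UU _ (fun k => lam k - ls0)
    (gamma * rho * V xs0 ls0 0%N).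
    apply: le_trans
      (sqnorm_le_lyapunov hrho hgamma hP heps hslack xs0 _ (x k) _) _.
    rewrite ler_pM2l ?mulr_gt0 //; exact: VleV0.
  exists (q' + ls0); rewrite -[lam](subrK (fun=> ls0)).
  by apply: cvgD => //; exact: cvg_cst.
pose q i := sval (cid (ex_q i)).
have qP i : (fun k => x k i) @ U --> q i := svalP (cid (ex_q i)).
have dU i := cvgU _ _ _ (dcvg i).
(* Convergence along an ultrafilter need not survive an index shift; the vanishing increments supply
   the shifted limit. *)
have qP1 i : (fun k => x k.+1 i) @ U --> q i.
  rewrite -[q i]add0r; under eq_fun => k do rewrite -[x k.+1 i](subrK (x k i)).
  by apply: cvgD; [exact: dU|exact: qP].
have rU1 : (fun k => residual A c (x k.+1)) @ U --> residual A c q.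
  apply: cvgB; last exact: cvg_cst.
  by apply: cvg_sumr => i; exact: cvg_mulmx.
have rU : (fun k => residual A c (x k)) @ U --> residual A c q.
  apply: cvgB; last exact: cvg_cst.
  by apply: cvg_sumr => i; exact: cvg_mulmx.
have rq0 : residual A c q = 0.
  exact: (cvg_unique _ rU1 (cvgU _ _ _ rcvg)).
have spq : saddle_point A c f q ls.
  split=> [i|]; last by apply/eqP; rewrite -subr_eq0; apply/eqP.
  have [flsc fP _] := hf i.
  (* The subgradient at [x k.+1 i] is built from the iterates at [k]. Along [U] its residual and
     increment terms vanish, leaving [(A i)^T *m ls]. *)
  apply: (subdifferential_closed flsc fP (qP1 i)
    (g := fun k => (A i)^T *m (lam k - rho *: residual A c (x k))
                   - prox_metric A rho P i *m (x k.+1 i - x k i))); last first.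
    by move=> k; apply: subdifferential_prox_step => //; exact: (hseq k).1.
  rewrite -[_ *m ls]subr0 -(mulmx0 _ (prox_metric A rho P i)).
  apply: cvgB; apply: cvg_mulmx; last exact: dU.
  rewrite -[X in _ --> X]subr0 -(scaler0 _ rho) -rq0.
  by apply: cvgB => //; exact: cvgZr.
(* The energy is continuous in the iterates and vanishes at its own reference point [(q, ls)]. *)
have VU : V q ls @ U --> (0 : R).
  have -> : 0 = (gamma * rho)^-1 * sqnorm_mx 1%:M (ls - ls) +
      \sum_(i < N) sqnorm_mx (prox_metric A rho P i) (q i - q i).
    rewrite subrr big1 ?sqnorm_mxE ?mulmx0 ?dotv0r ?mulr0 ?addr0// => j _.
    by rewrite subrr sqnorm_mxE mulmx0 dotv0r.
  apply: cvgD.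
    under eq_fun do rewrite -sqnorm_mx1.
    apply: cvgM; first exact: cvg_cst.
    by apply: cvg_sqnorm_mx; apply: cvgB => //; exact: cvg_cst.
  apply: cvg_sumr => i; apply: cvg_sqnorm_mx.
  by apply: cvgB; [exact: qP|exact: cvg_cst].
have Vcvg : V q ls @ \oo --> (0 : R).
  by apply: cvg0_nonincreasing VU => //; exact: Vdecr.
exists q, ls; split=> // [i|].
  (* Each block error in its metric is squeezed between 0 and the energy; the multiplier error is
     treated likewise below. *)
  have xq : (fun k => x k i - q i) @ \oo --> (0 : 'cV[R]_(n i)).
    apply: (cvg0_sqnorm_mx (Gpos i)).
    apply: (@squeeze_cvgr _ _ _ _ (fun=> 0) _ _ _ 0 (cvg_cst 0) Vcvg).
    apply: filterE => k; rewrite posdefmx_ge0 //=.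
    exact: (sqnorm_mx_le_lyapunov hrho hgamma hP heps hslack).
  exact/subr_cvg0.
have lq : (fun k => lam k - ls) @ \oo --> (0 : 'cV[R]_m).
  apply: (cvg0_sqnorm_mx (posdefmx1 m)).
  have gV : (fun k => gamma * rho * V q ls k) @ \oo --> (0 : R).
    by rewrite -(mulr0 (gamma * rho)); apply: cvgM => //; exact: cvg_cst.
  apply: (@squeeze_cvgr _ _ _ _ (fun=> 0) _ _ _ 0 (cvg_cst 0) gV).
  apply: filterE => k; rewrite sqnorm_mx1 sqnorm_ge0 /=.
  exact: (sqnorm_le_lyapunov hrho hgamma hP heps hslack).
exact/subr_cvg0.
Qed.
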